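(* Let $n\ge3$ and let $u[k]=\exp(2\pi i k/n)$, $k\in\mathbb{Z}$. In the complex plane $\mathbb{C}\cong\mathbb{R}^2$, the sequence of points $z_0=0$ and $z_k=(\mathcal{I}u)[k]=\sum_{j=1}^k u[j]$ for $k=1,\dots,n$ forms the (consecutive) vertices of an equilateral, equiangular regular $n$-gon having one vertex at the origin, $z_0=z_n=0$. The polygon is inscribed in a circle of circumradius $$R_n=\frac{1}{2\sin(\pi/n)}$$ with circumcenter $$Z_{\mathrm{center}}=R_n\,e^{i\left(\frac{\pi}{2}+\frac{\pi}{n}\right)}=\frac{i}{2}\Bigl(i+\cot\bigl(\tfrac{\pi}{n}\bigr)\Bigr).$$
   Context: For a sequence $u:\mathbb{Z}\to\mathbb{C}$, the discrete cumulative integral is $(\mathcal{I}u)[k]=\sum_{j=1}^k u[j]$ for $k\ge1$. *)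

(* Defs.v *)
From HB Require Import structures.
From mathcomp Require Export all_boot all_order all_algebra.
From mathcomp Require Export reals sequences trigo.
From mathcomp.real_closed Require Export complex.

Set Implicit Arguments.
Unset Strict Implicit.
Unset Printing Implicit Defensive.

Import Order.TTheory GRing.Theory Num.Theory ComplexField.Normc.
Local Open Scope ring_scope.
Local Open Scope complex_scope.

Definition cot (R : realType) (x : R) : R := cos x / sin x.

(* The complex exponential: e^(x + i y) = e^x (cos y + i sin y). *)
Definition cexp (R : realType) (z : R[i]) : R[i] :=
  (expR (complex.Re z))%:C * (cos (complex.Im z) +i* sin (complex.Im z)).

Definition cumint (R : realType) (u : int -> R[i]) (k : nat) : R[i] :=
  \sum_(1 <= j < k.+1) u j%:Z.

(* R[i] viewed as the Euclidean plane; its Euclidean norm is [normc], which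
   is R-valued (whereas `|z| lives in R[i]). *)
Definition dot (R : realType) (v w : R[i]) : R :=
  complex.Re v * complex.Re w + complex.Im v * complex.Im w.

(* Positive iff w lies strictly to the left of the direction v. *)
Definition cross (R : realType) (v w : R[i]) : R :=
  complex.Re v * complex.Im w - complex.Im v * complex.Re w.

Definition on_segment (R : realType) (a b w : R[i]) : Prop :=
  exists2 t : R, 0 <= t <= 1 & w = a + t%:C * (b - a).

(* The angle at b of the triangle a b c, in [0, pi]. *)
Definition angle (R : realType) (a b c : R[i]) : R :=
  acos (dot (a - b) (c - b) / (normc (a - b) * normc (c - b))).

(* A closed polygon is given by its consecutive vertices p 0, ..., p (n - 1);
   [ordS] and [ord_pred] are the successor and predecessor modulo n, so the
   i-th side joins p i to p (ordS i). *)

Definition simple_polygon (R : realType) (n : nat) (p : 'I_n -> R[i]) : Prop :=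
  (forall i, p i <> p (ordS i)) /\
  (forall i j, i != j -> forall w,
     on_segment (p i) (p (ordS i)) w -> on_segment (p j) (p (ordS j)) w ->
     (j = ordS i /\ w = p j) \/ (i = ordS j /\ w = p i)).

(* The polygon lies on one side of the line supporting each of its sides. *)
Definition convex_polygon (R : realType) (n : nat) (p : 'I_n -> R[i]) : Prop :=
  forall i,
    (forall j, 0 <= cross (p (ordS i) - p i) (p j - p i)) \/
    (forall j, cross (p (ordS i) - p i) (p j - p i) <= 0).

Definition equilateral (R : realType) (n : nat) (p : 'I_n -> R[i]) : Prop :=
  forall i j, normc (p (ordS i) - p i) = normc (p (ordS j) - p j).

(* For a convex polygon, the interior angle at a vertex is the angle in
   [0, pi] between the two sides meeting there. *)
Definition equiangular (R : realType) (n : nat) (p : 'I_n -> R[i]) : Prop :=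
  forall i j, angle (p (ord_pred i)) (p i) (p (ordS i))
            = angle (p (ord_pred j)) (p j) (p (ordS j)).

(* Simplicity and convexity exclude the regular star polygons, which are also
   equilateral and equiangular. *)
Definition regular_polygon (R : realType) (n : nat) (p : 'I_n -> R[i]) : Prop :=
  [/\ simple_polygon p, convex_polygon p, equilateral p & equiangular p].

Definition inscribed (R : realType) (n : nat) (p : 'I_n -> R[i])
    (center : R[i]) (radius : R) : Prop :=
  0 < radius /\ forall i, normc (p i - center) = radius.

(* Main.v *)
Require Import Defs.
From mathcomp Require Import zify ring.

Set Implicit Arguments.
Unset Strict Implicit.
Unset Printing Implicit Defensive.

Import Order.TTheory GRing.Theory Num.Theory.
Import ComplexField.Normc.
Local Open Scope ring_scope.
Local Open Scope complex_scope.

(** Write t = pi / n and R_n = 1 / (2 sin t).  Each step u k = exp (2 i k t) of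
    the sum is a chord of the circle of radius R_n: two points of it whose
    arguments are 2 k t - pi / 2 + t and 2 k t - pi / 2 - t differ by exactly
    2 R_n sin t exp (2 i k t) = u k ([cis_chord]).  The second argument of one
    step is the first argument of the previous one, so the sum telescopes
    ([sum_cis]):
      z k = Z + R_n exp (i (t - pi / 2 + 2 k t)),
    with Z = R_n exp (i (pi / 2 + t)), the opposite of the point with k = 0.
    This gives the circumscribed circle at once, and z n = z 0 because the
    argument has then grown by a full turn.

    It remains to see that n points equally spaced on a circle, taken in the
    order of their arguments, form a regular polygon
    ([equally_spaced_regular]).  The side leaving vertex k is a vector of fixed
    length 2 R_n sin t which turns by 2 t when k grows by 1, so all sides and
    all angles are equal.  For the shape, the cross product of the i-th side
    with the vector from vertex i to vertex j is a positive multiple of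
    sin ((j - i) t) sin ((j - i - 1) t) ([cross_side]), which is positive unless
    j is one of the two ends of the side: the polygon is strictly convex.
    Strict convexity alone implies that distinct sides meet only at a common
    vertex ([strictly_convex_simple]). *)

(** * Convex polygons *)

Lemma ordS_ordS_neq (n : nat) (i : 'I_n) : (2 < n)%N -> ordS (ordS i) != i.
Proof.
move=> n2; apply/eqP => /(congr1 val) /=.
have ilt := ltn_ord i.
rewrite -addn1 modnDml addn1.
have [lt|ge] := ltnP i.+2 n; first by rewrite modn_small //; lia.
have -> : i.+2 = (i.+2 - n + n)%N by lia.
by rewrite modnDr modn_small; lia.
Qed.

Lemma ordS_neq (n : nat) (i : 'I_n) : (2 < n)%N -> ordS i != i.
Proof.
by move=> n2; apply: contraNneq (ordS_ordS_neq i n2) => e; rewrite !e.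
Qed.

Lemma cross_affine (R : realType) (v a b c : R[i]) (t : R) :
  cross v (b + t%:C * (c - b) - a)
  = (1 - t) * cross v (b - a) + t * cross v (c - a).
Proof. by case: v a b c => [? ?] [? ?] [? ?] [? ?]; rewrite /cross /=; ring. Qed.

Lemma cross_self (R : realType) (v : R[i]) : cross v v = 0.
Proof. by case: v => a b; rewrite /cross /=; ring. Qed.

(** The polygon is traversed counterclockwise, so that every vertex off a side
    lies strictly to its left. *)
Definition strictly_convex (R : realType) (n : nat) (p : 'I_n -> R[i]) :=
  forall i j, j != i -> j != ordS i -> 0 < cross (p (ordS i) - p i) (p j - p i).

Lemma strictly_convex_ge0 (R : realType) (n : nat) (p : 'I_n -> R[i]) i j :
  strictly_convex p -> 0 <= cross (p (ordS i) - p i) (p j - p i).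
Proof.
move=> cvx; have [->|ji] := eqVneq j i.
  by rewrite subrr /cross /= !mulr0 subr0.
have [->|jSi] := eqVneq j (ordS i); first by rewrite cross_self.
exact/ltW/cvx.
Qed.

Lemma strictly_convex_eq0 (R : realType) (n : nat) (p : 'I_n -> R[i]) i j :
  strictly_convex p -> cross (p (ordS i) - p i) (p j - p i) = 0 ->
  j = i \/ j = ordS i.
Proof.
move=> cvx e; have [|ji] := eqVneq j i; first by left.
have [|jSi] := eqVneq j (ordS i); first by right.
by have := cvx _ _ ji jSi; rewrite e ltxx.
Qed.

Lemma strictly_convex_convex (R : realType) (n : nat) (p : 'I_n -> R[i]) :
  strictly_convex p -> convex_polygon p.
Proof. by move=> cvx i; left=> j; apply: strictly_convex_ge0. Qed.

(** The signed distance to the line of the i-th side vanishes at a common point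
    w of the sides i and j.  It is affine along the side j and nonnegative at its
    two ends, so it vanishes at each end that has nonzero weight in w; but it
    vanishes at no vertex other than the ends of the side i.  Having at least
    three vertices rules out that both ends of the side j are ends of the
    side i. *)
Lemma strictly_convex_simple (R : realType) (n : nat) (p : 'I_n -> R[i]) :
  (2 < n)%N -> strictly_convex p -> simple_polygon p.
Proof.
move=> n2 cvx; split=> [i e|i j neq w [s _ ws] [t /andP[t0 t1] wt]].
  (* A side of length zero would have no point strictly to its left. *)
  have ne : ordS (ordS i) != ordS i by rewrite ordS_neq.
  have := cvx _ _ (ordS_ordS_neq i n2) ne.
  by rewrite -e subrr /cross /= !mul0r subrr ltxx.
have ge0 k := strictly_convex_ge0 i k cvx.
have eq0 k : _ -> k = i \/ k = ordS i := strictly_convex_eq0 cvx.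
set e := p (ordS i) - p i in ge0 eq0.
have w0 : cross e (w - p i) = 0.
  rewrite ws -/e addrAC subrr add0r.
  by case: (e) => a b; rewrite /cross /=; ring.
move: w0; rewrite wt cross_affine => /eqP.
rewrite paddr_eq0 ?(mulr_ge0 _ (ge0 _)) ?subr_ge0 //.
rewrite !mulf_eq0 subr_eq0.
case/andP=> hj hSj.
(* Either w is the far end of the side j, or the near end p j has nonzero weight
   in w and is then the far end of the side i. *)
have [t1'|tn1] := eqVneq t 1.
  move: hSj; rewrite t1' oner_eq0 /= => /eqP /eq0 [<-|/ordS_inj ji].
    by right; split=> //; ring.
  by rewrite ji eqxx in neq.
move: hj; rewrite eq_sym (negPf tn1) /= => /eqP /eq0 [ji|jSi].
  by rewrite ji eqxx in neq.
left; split=> //; case/orP: hSj => [/eqP ->|/eqP /eq0]; first by ring.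
rewrite jSi => -[|/ordS_inj] /eqP; first by rewrite (negPf (ordS_ordS_neq i n2)).
by rewrite (negPf (ordS_neq i n2)).
Qed.

(** * Points of the unit circle *)

Definition cis (R : realType) (x : R) : R[i] := cos x +i* sin x.

Lemma normc_cis (R : realType) (x : R) : normc (cis x) = 1.
Proof. by rewrite /= cos2Dsin2 sqrtr1. Qed.

Lemma normc_real (R : realType) (r : R) : 0 <= r -> normc r%:C = r.
Proof. by move=> r0 /=; rewrite expr0n addr0 sqrtr_sqr ger0_norm. Qed.

Lemma cisD2pi (R : realType) (x : R) : cis (x + pi *+ 2) = cis x.
Proof. by rewrite /cis cosD2pi sinD2pi. Qed.

Lemma full_turn (R : realType) (n : nat) : (0 < n)%N ->
  n%:R * (2 * (pi / n%:R)) = pi *+ 2 :> R.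
Proof.
move=> n0; rewrite mulrCA [n%:R * _]mulrC divfK ?mulr_natl //.
by rewrite pnatr_eq0; lia.
Qed.

Lemma cross_cis (R : realType) (x y : R) : cross (cis x) (cis y) = sin (y - x).
Proof. by rewrite /cross /= sinB; ring. Qed.

Lemma dot_cis (R : realType) (x y : R) : dot (cis x) (cis y) = cos (y - x).
Proof. by rewrite /dot /= cosB; ring. Qed.

Lemma cexp_imag (R : realType) (x : R) : cexp ('i%C * x%:C) = cis x.
Proof.
have -> : 'i%C * x%:C = 0 +i* x by simpc.
by rewrite /cexp /= exp.expR0 mul1r.
Qed.

(** The chord joining two points of the unit circle is orthogonal to the radius
    at the middle of the arc between them. *)
Lemma cis_chord (R : realType) (x t : R) :
  cis (x + t) - cis (x - t) = (2 * sin t)%:C * cis (x + pi / 2).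
Proof.
rewrite /cis cosDpihalf sinDpihalf sinD cosD sinB cosB; simpc.
by congr (_ +i* _); ring.
Qed.

Lemma sin_mulrn_gt0 (R : realType) (n m : nat) : (0 < m < n)%N ->
  0 < sin (m%:R * (pi / n%:R) : R).
Proof.
case/andP=> m0 mn; apply: sin_gt0_pi.
have n0 : (0 < n)%N by lia.
rewrite mulr_gt0 ?divr_gt0 ?pi_gt0 ?ltr0n //=.
by rewrite mulrCA gtr_pMr ?pi_gt0 // ltr_pdivrMr ?ltr0n // mul1r ltr_nat.
Qed.

Lemma sin_pi_div_gt0 (R : realType) (n : nat) : (1 < n)%N ->
  0 < sin (pi / n%:R : R).
Proof. by move=> n1; rewrite -[pi / _]mul1r (@sin_mulrn_gt0 R n 1). Qed.

(** * Equally spaced points of a circle *)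

Section EquallySpaced.
Variables (R : realType) (n : nat) (c : R[i]) (rho alpha : R) (p : 'I_n -> R[i]).
Hypotheses (n2 : (2 < n)%N) (rho0 : 0 < rho).
Local Notation theta := (pi / n%:R : R).
Hypothesis pE :
  forall i : 'I_n, p i = c + rho%:C * cis (alpha + i%:R * (2 * theta)).

(** The vertex with index n would coincide with the one with index 0, so the
    cyclic successor can be replaced by the successor in nat. *)
Lemma cis_ordS (x : R) (i : 'I_n) :
  cis (x + (ordS i)%:R * (2 * theta)) = cis (x + i.+1%:R * (2 * theta)).
Proof.
rewrite /=; have := ltn_ord i; rewrite leq_eqVlt => /orP[/eqP e|lt].
  by rewrite e modnn mul0r addr0 full_turn ?cisD2pi //; lia.
by rewrite modn_small.
Qed.

Let side := 2 * sin theta * rho.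

Lemma side_gt0 : 0 < side.
Proof. by rewrite !mulr_gt0 // sin_pi_div_gt0 // ltnW. Qed.

Lemma sideE (i : 'I_n) : p (ordS i) - p i =
  side%:C * cis (alpha + theta + pi / 2 + i%:R * (2 * theta)).
Proof.
rewrite !pE cis_ordS.
set m := alpha + theta + i%:R * (2 * theta).
have -> : alpha + i.+1%:R * (2 * theta) = m + theta.
  by rewrite /m -addn1 natrD; ring.
have -> : alpha + i%:R * (2 * theta) = m - theta by rewrite /m; ring.
have -> : alpha + theta + pi / 2 + i%:R * (2 * theta) = m + pi / 2.
  by rewrite /m; ring.
rewrite opprD addrACA subrr add0r -mulrBr cis_chord mulrA -rmorphM.
by rewrite /side mulrC [rho * _]mulrC mulrC.
Qed.

Lemma sideSE (i : 'I_n) : p (ordS (ordS i)) - p (ordS i) =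
  side%:C * cis (alpha + theta + pi / 2 + i.+1%:R * (2 * theta)).
Proof. by rewrite sideE cis_ordS. Qed.

(** Expanding the cross product of two sums of points of the circle gives
    cos t - cos ((2 d - 1) t) with t = pi / n and d = j - i, which factors as
    2 sin (d t) sin ((d - 1) t). *)
Lemma cross_side (i j : 'I_n) : cross (p (ordS i) - p i) (p j - p i) =
  2 * side * rho * (sin ((j%:R - i%:R) * theta)
                    * sin ((j%:R - i.+1%:R) * theta)).
Proof.
rewrite sideE !pE.
set x := alpha + i%:R * _; set y := alpha + j%:R * _; set m := _ + i%:R * _.
have -> : cross (side%:C * cis m) (c + rho%:C * cis y - (c + rho%:C * cis x))
          = side * rho * (cross (cis m) (cis y) - cross (cis m) (cis x)).
  by case: c => a b; rewrite /cross /=; ring.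
rewrite !cross_cis.
set d := (j%:R - i%:R) * theta; set e := (j%:R - i.+1%:R) * theta.
have -> : y - m = (d + e) - pi / 2.
  by rewrite /y /m /d /e -addn1 natrD; ring.
have -> : x - m = (e - d) - pi / 2.
  by rewrite /x /m /d /e -addn1 natrD; ring.
by rewrite !sinBpihalf cosD cosB; ring.
Qed.

(** The product of sines in [cross_side] involves two consecutive multiples of
    pi / n; they are either both nonnegative or both nonpositive, and the sign
    changes cancel in the second case.  Excluding the ends of the side keeps
    the absolute values of both multiples strictly between 0 and pi. *)
Lemma equally_spaced_strictly_convex : strictly_convex p.
Proof.
move=> i j ji jSi; rewrite cross_side.
suff h : exists2 m, (0 < m /\ m.+1 < n)%N &
    sin ((j%:R - i%:R) * theta) * sin ((j%:R - i.+1%:R) * theta) =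
    sin (m%:R * theta) * sin (m.+1%:R * theta).
  case: h => m [m0 mn] ->.
  have k0 : 0 < 2 * side * rho by rewrite (mulr_gt0 _ rho0) // mulr_gt0 ?side_gt0.
  by rewrite (mulr_gt0 k0) // mulr_gt0 ?sin_mulrn_gt0 //; lia.
have iN := ltn_ord i; have jN := ltn_ord j.
(* If j is beyond i, then m = j - i - 1; otherwise m = i - j.  The two exceptional
   values of j are those for which m = 0 or m + 1 = n. *)
have [ij|ij] := ltnP i j.
  have jSi' : j <> i.+1 :> nat.
    move=> e; case/eqP: jSi; apply: val_inj => /=.
    by rewrite modn_small; lia.
  exists (j - i.+1)%N; first by lia.
  have -> : (j - i.+1).+1 = (j - i)%N by lia.
  by rewrite mulrC !natrB //; lia.
have ji' : j <> i :> nat by move=> /val_inj /eqP; rewrite (negPf ji).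
have ij' : ((i - j).+1 < n)%N.
  rewrite ltnNge; apply/negP => le; case/eqP: jSi; apply: val_inj => /=.
  have -> : (i.+1 = n)%N by lia.
  by rewrite modnn; lia.
exists (i - j)%N; first by lia.
have -> : (i - j).+1 = (i.+1 - j)%N by lia.
rewrite !natrB //; last by lia.
by rewrite -(opprB j%:R i%:R) -(opprB j%:R i.+1%:R) !mulNr !sinN mulrNN.
Qed.

Lemma normc_side (i : 'I_n) : normc (p (ordS i) - p i) = side.
Proof. by rewrite sideE normcM normc_cis mulr1 normc_real // ltW // side_gt0. Qed.

(** The angle between consecutive sides is computed at a vertex of the form
    [ordS k], where it involves the sides k and k + 1; every vertex has this
    form. *)
Lemma equally_spaced_regular : regular_polygon p.
Proof.
split.
- exact: strictly_convex_simple n2 equally_spaced_strictly_convex.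
- exact: strictly_convex_convex equally_spaced_strictly_convex.
- by move=> i j; rewrite !normc_side.
have angleE k : angle (p k) (p (ordS k)) (p (ordS (ordS k)))
                = acos (- cos (2 * theta)).
  rewrite /angle -(opprB (p (ordS k))) normcN !normc_side.
  congr (acos _).
  rewrite sideSE sideE; set x := _ + k%:R * _; set y := _ + k.+1%:R * _.
  have -> : dot (- (side%:C * cis x)) (side%:C * cis y)
            = - cos (2 * theta) * (side * side).
    have -> : 2 * theta = y - x by rewrite /y /x -addn1 natrD; ring.
    by rewrite -dot_cis /dot /=; ring.
  by rewrite mulfK // mulf_neq0 // gt_eqF ?side_gt0.
by move=> i j; rewrite -(ord_predK i) -(ord_predK j) !ordSK !angleE.
Qed.

End EquallySpaced.

(** The sum telescopes when each term is written as a chord of the circle of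
    radius 1 / (2 sin t); the constant term is the opposite of the initial point
    of the first chord, that is, the center of the circle through the partial
    sums. *)
Lemma sum_cis (R : realType) (t : R) (k : nat) : sin t != 0 ->
  \sum_(1 <= j < k.+1) cis (j%:R * (2 * t))
  = (1 / (2 * sin t))%:C *
    (cis (pi / 2 + t) + cis (t - pi / 2 + k%:R * (2 * t))).
Proof.
move=> t0; elim: k => [|k IH].
  rewrite big_geq // mul0r addr0 addrC.
  (* The two points are antipodal. *)
  have -> : cis (t - pi / 2) = - cis (t + pi / 2).
    rewrite /cis cosDpihalf sinDpihalf cosBpihalf sinBpihalf.
    by simpc.
  by rewrite [pi / 2 + t]addrC addNr mulr0.
rewrite big_nat_recr //= IH; set x := k.+1%:R * (2 * t).
have -> : cis x = (1 / (2 * sin t))%:C * ((2 * sin t)%:C * cis (x - pi / 2 + pi / 2)).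
  by rewrite mulrA -rmorphM subrK /= divfK ?mul1r // mulf_neq0 ?pnatr_eq0.
rewrite -cis_chord -mulrDr -addrA; congr (_ * (_ + _)).
have -> : t - pi / 2 + k%:R * (2 * t) = x - pi / 2 - t.
  by rewrite /x -addn1 natrD; ring.
have -> : x - pi / 2 + t = t - pi / 2 + x by ring.
by ring.
Qed.

Theorem theorem8p4 (R : realType) (n : nat) (hn : (3 <= n)%N)
    (u : int -> R[i])
    (hu : forall k : int,
       u k = cexp (2%:R * (pi : R)%:C * 'i%C * k%:~R / n%:R))
    (z : nat -> R[i]) (hz0 : z 0%N = 0)
    (hz : forall k : nat, (1 <= k <= n)%N -> z k = cumint u k) :
  let Rn : R := 1 / (2%:R * sin (pi / n%:R)) in
  let Zcenter : R[i] :=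
    Rn%:C * cexp ('i%C * (pi / 2%:R + pi / n%:R : R)%:C) in
  let p : 'I_n -> R[i] := fun k => z k in
  [/\ regular_polygon p,
      z 0%N = z n /\ z n = 0,
      inscribed p Zcenter Rn
    & Zcenter = 'i%C / 2%:R * ('i%C + (cot (pi / n%:R : R))%:C)].
Proof.
move=> Rn Zcenter p.
set t : R := pi / n%:R in Rn Zcenter *.
have s0 : 0 < sin t by rewrite sin_pi_div_gt0 // ltnW.
have Rn0 : 0 < Rn by rewrite divr_gt0 // mulr_gt0.
have ZE : Zcenter = Rn%:C * cis (pi / 2 + t) by rewrite /Zcenter cexp_imag.
have uE (j : nat) : u j%:Z = cis (j%:R * (2 * t)).
  rewrite hu -cexp_imag; congr cexp.
  by rewrite /t !rmorphM /= fmorphV !rmorph_nat -pmulrn; ring.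
have zE k : (k <= n)%N ->
    z k = Zcenter + Rn%:C * cis (t - pi / 2 + k%:R * (2 * t)).
  move=> kn; rewrite ZE -mulrDr -sum_cis ?gt_eqF //.
  case: k kn => [|k] kn; first by rewrite hz0 big_geq.
  by rewrite hz // /cumint; apply: eq_bigr => j _; rewrite uE.
have zn : z n = 0.
  by rewrite -hz0 !zE // mul0r addr0 full_turn ?cisD2pi //; lia.
have pE (i : 'I_n) : p i = Zcenter + Rn%:C * cis (t - pi / 2 + i%:R * (2 * t)).
  by rewrite /p zE // ltnW.
split.
- exact: equally_spaced_regular hn Rn0 pE.
- by rewrite zn hz0.
- split=> // i; rewrite pE addrC addKr normcM normc_cis mulr1 normc_real //.
  exact: ltW.
- rewrite ZE addrC /cis cosDpihalf sinDpihalf /Rn /cot.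
  have -> : 'i%C / 2%:R = 0 +i* (1 / 2) :> R[i].
    apply: (mulIf (x := 2%:R)); first by rewrite pnatr_eq0.
    rewrite divfK ?pnatr_eq0 //.
    rewrite -(rmorph_nat (real_complex R)) /=; simpc.
    by rewrite mulVf ?pnatr_eq0.
  simpc; congr (_ +i* _); field; exact/lt0r_neq0.
Qed.
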